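(* Let $q\in\mathbb{C}$ with $0<|q|<1$, let $h\in\mathbb{Z}^{+}$, let $\xi\in\mathbb{C}$ be a root of unity, and let $a,f$ be integers with $0<a<f$. The function $s\mapsto H_{\xi,q}^{(h)}(s,a:f)$ is meromorphic on $\mathbb{C}$ with a simple pole at $s=1$, having residue $$\operatorname{Res}_{s=1}H_{\xi,q}^{(h)}(s,a:f)=\lim_{s\to1}(s-1)H_{\xi,q}^{(h)}(s,a:f)=\frac{q^{ha}\xi^{a}\log q^{h}}{q^{hf}\xi^{f}-1}.$$
   Context: Fix a value of $\log q$, and put $\log q^{h}=h\log q$. The twisted $(h,q)$-partial zeta function is defined, for complex $s\neq 1$ and integers $0<a<f$, by $$H_{\xi,q}^{(h)}(s,a:f)=\sum_{\substack{n\equiv a\,(\mathrm{mod}\, f)\\ n>0}}\frac{q^{nh}\xi^{n}}{n^{s}}-\frac{\log q^{h}}{s-1}\sum_{\substack{n\equiv a\,(\mathrm{mod}\, f)\\ n>0}}\frac{q^{nh}\xi^{n}}{n^{s-1}}.$$ *)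

(* Defs.v *)
From Stdlib Require Import Reals Arith.
From Coquelicot Require Import Coquelicot.

Local Open Scope C_scope.

(** * Complex functions *)

Definition Cexp (z : C) : C :=
  (exp (Re z) * cos (Im z), exp (Re z) * sin (Im z))%R.

(** [n ^ s] for [n > 0], with the real logarithm of [n]. *)
Definition npow (n : nat) (s : C) : C := Cexp (s * RtoC (ln (INR n))).

(** Sum of a complex series, taken componentwise so as to be total; it is the
    sum of the series whenever the series converges: see [CSeries_unique]. *)
Definition CSeries (u : nat -> C) : C :=
  (Series (fun n => Re (u n)), Series (fun n => Im (u n))).

Lemma CSeries_unique (u : nat -> C) (l : C) :
  is_series (K := C_AbsRing) (V := C_NormedModule) u l -> CSeries u = l.
Proof.
intros Hu.
assert (Hsum : forall n, sum_n (G := C_AbelianMonoid) u n =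
  (sum_n (fun k => Re (u k)) n, sum_n (fun k => Im (u k)) n)).
{ induction n as [|n IH].
  - rewrite !sum_O; apply surjective_pairing.
  - rewrite !sum_Sn, IH; reflexivity. }
unfold CSeries; rewrite (surjective_pairing l); f_equal.
- apply is_series_unique; intros P [e He].
  destruct (Hu (fun z => P (fst z))) as [N HN].
  { exists e; intros y [Hy _]; apply He, Hy. }
  exists N; intros n Hn; specialize (HN n Hn); rewrite Hsum in HN; exact HN.
- apply is_series_unique; intros P [e He].
  destruct (Hu (fun z => P (snd z))) as [N HN].
  { exists e; intros y [_ Hy]; apply He, Hy. }
  exists N; intros n Hn; specialize (HN n Hn); rewrite Hsum in HN; exact HN.
Qed.

(** Complex differentiable in a neighbourhood of [z0]. *)
Definition holomorphic_at (f : C -> C) (z0 : C) : Prop :=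
  locally (T := C_UniformSpace) z0
    (fun z => ex_derive (K := C_AbsRing) (V := C_NormedModule) f z).

(** [locally'] is the punctured neighbourhood filter, so the value of [f] at
    [z0] is irrelevant. *)
Definition pole_of_order (f : C -> C) (z0 : C) (m : nat) : Prop :=
  (0 < m)%nat /\
  exists g : C -> C,
    holomorphic_at g z0 /\ g z0 <> 0 /\
    locally' (T := C_UniformSpace) z0 (fun z => f z = g z / (z - z0) ^ m).

Definition simple_pole (f : C -> C) (z0 : C) : Prop := pole_of_order f z0 1.

(** Meromorphic on the whole plane: every point is a regular point or a pole
    (poles are isolated since [f] is holomorphic near each of them). *)
Definition meromorphic (f : C -> C) : Prop :=
  forall z : C, holomorphic_at f z \/ exists m : nat, pole_of_order f z m.

(** Residue at a pole (or a regular point): the coefficient [b 0] of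
    [(z - z0)^(-1)] in the Laurent expansion
    [f z = b m / (z - z0)^(m+1) + ... + b 0 / (z - z0) + g z], [g] being the
    holomorphic part. *)
Definition is_residue (f : C -> C) (z0 r : C) : Prop :=
  exists (m : nat) (b : nat -> C) (g : C -> C),
    holomorphic_at g z0 /\
    locally' (T := C_UniformSpace) z0
      (fun z => f z =
         sum_n (G := C_AbelianMonoid) (fun k => b k / (z - z0) ^ (S k)) m + g z) /\
    b 0%nat = r.

(** * The twisted (h,q)-partial zeta function *)

Definition in_class (a f n : nat) : bool :=
  Nat.ltb 0 n && Nat.eqb (n mod f) (a mod f).

Definition partial_sum (q xi : C) (h a f : nat) (s : C) : C :=
  CSeries (fun n =>
    if in_class a f n then q ^ (n * h) * xi ^ n / npow n s else 0).

(** [logq] is the chosen value of [log q]; then [log q^h] is [h * logq].  At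
    [s = 1] the value is a dummy one, since division in [C] is total. *)
Definition partial_zeta (q logq xi : C) (h a f : nat) (s : C) : C :=
  partial_sum q xi h a f s
  - RtoC (INR h) * logq / (s - 1) * partial_sum q xi h a f (s - 1).

(* Main.v *)
Require Import Defs.
From Stdlib Require Import Reals Arith Lia Lra.
From Coquelicot Require Import Coquelicot.

Local Open Scope C_scope.

(** With [w = q^h xi], [|w| < 1] and [L = log q^h], the function is
    [F s - L / (s - 1) * F (s - 1)], where [F s] is the sum of [w^n n^(-s)] over the
    residue class.  The geometric decay of [w^n] beats every power of [n], so the Taylor
    remainders of [exp] may be summed termwise: [F] is complex differentiable everywhere,
    and so is its slope [(F s - F 0) / s], by the second-order expansion at [0].  Hence the
    only singularity is at [1], with residue [- L * F 0], and [F 0] is a geometric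
    progression of ratio [w^f] and first term [w^a]. *)

Notation ex_Cseries := (ex_series (K := C_AbsRing) (V := C_NormedModule)).
Notation is_Cseries := (is_series (K := C_AbsRing) (V := C_NormedModule)).
Notation is_Cderive := (is_derive (K := C_AbsRing) (V := C_NormedModule)).
Notation ex_Cderive := (ex_derive (K := C_AbsRing) (V := C_NormedModule)).

(** * Complex differentiation *)

(** Every derivative computed by hand below (inverse, Dirichlet series, slope at 0) comes from such
    a bound. For |u| < eps / (|K| + 1) the remainder is at most eps |u|; the denominator |K| + 1
    stays positive whatever the sign of K. *)
Lemma is_Cderive_quadratic (f : C -> C) (z l : C) (K d : R) :
  (0 < d)%R ->
  (forall u, (Cmod u < d)%R ->
     (Cmod (f (z + u) - f z - u * l)%C <= K * Cmod u ^ 2)%R) ->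
  is_Cderive f z l.
Proof.
intros Hd Hf; split; [apply is_linear_scal_l|].
intros x Hx.
pose proof (is_filter_lim_locally_unique (K := C_AbsRing)
  (V := AbsRing_NormedModule C_AbsRing) z x Hx); subst x; clear Hx.
intros eps.
assert (HK : (0 < Rabs K + 1)%R) by (pose proof (Rabs_pos K); lra).
assert (Hr : (0 < Rmin d (eps / (Rabs K + 1)))%R).
{ apply Rmin_glb_lt; [assumption|]; apply Rdiv_lt_0_compat; [apply cond_pos|lra]. }
exists (mkposreal _ Hr); intros y Hy.
change (Cmod (y - z)%C < Rmin d (eps / (Rabs K + 1)))%R in Hy.
change (Cmod (f y - f z - (y - z) * l)%C <= eps * Cmod (y - z)%C)%R.
set (u := y - z) in *.
replace y with (z + u) by (unfold u; ring).
assert (Hu1 : (Cmod u < d)%R) by (eapply Rlt_le_trans; [exact Hy|apply Rmin_l]).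
assert (Hu2 : (Cmod u < eps / (Rabs K + 1))%R)
  by (eapply Rlt_le_trans; [exact Hy|apply Rmin_r]).
eapply Rle_trans; [apply Hf, Hu1|].
pose proof (Cmod_ge_0 u).
assert (Hke : ((Rabs K + 1) * Cmod u <= eps)%R).
{ apply Rmult_lt_compat_l with (r := (Rabs K + 1)%R) in Hu2; [|assumption].
  replace ((Rabs K + 1) * (eps / (Rabs K + 1)))%R with (pos eps) in Hu2
    by (field; lra).
  lra. }
pose proof (Rle_abs K).
replace (K * Cmod u ^ 2)%R with ((K * Cmod u) * Cmod u)%R by ring.
apply Rmult_le_compat_r; [assumption|].
nra.
Qed.

Lemma ex_Cderive_inv (z : C) : z <> 0 -> ex_Cderive Cinv z.
Proof.
intros Hz.
pose proof (proj1 (Cmod_gt_0 z) Hz) as Hm.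
exists (- / (z * z)).
(* The remainder is exactly u^2 / (z^2 (z + u)), and |u| < |z| / 2 forces |z + u| >= |z| / 2, which
   gives this K. *)
apply is_Cderive_quadratic with (K := (2 / Cmod z ^ 3)%R) (d := (Cmod z / 2)%R); [lra|].
intros u Hu.
assert (Hzu : (Cmod z / 2 <= Cmod (z + u)%C)%R).
{ pose proof (Cmod_triangle (z + u) (- u)) as H.
  replace (z + u + - u) with z in H by ring.
  rewrite Cmod_opp in H; lra. }
assert (Hzu0 : z + u <> 0) by (apply Cmod_gt_0; lra).
replace (/ (z + u) - / z - u * - / (z * z))
  with (u ^ 2 * / (z ^ 2 * (z + u))) by (field; split; assumption).
rewrite Cmod_mult, Cmod_inv, Cmod_mult, !Cmod_pow
  by (apply Cmult_neq_0; [apply Cpow_nz|]; assumption).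
rewrite (Rmult_comm (2 / _)).
apply Rmult_le_compat_l; [apply pow2_ge_0|].
replace (2 / Cmod z ^ 3)%R with (/ (Cmod z ^ 2 * (Cmod z / 2)))%R by (field; lra).
assert (0 < Cmod z ^ 2)%R by (apply pow_lt; assumption).
apply Rinv_le_contravar.
- apply Rmult_lt_0_compat; lra.
- apply Rmult_le_compat_l; lra.
Qed.

(* Coquelicot puts two uniform structures on [C]: the product one of [C_NormedModule] and
   the one induced by [Cmod], used by the lemmas on functions from a ring to itself. *)
Lemma is_Cderive_AbsRing (f : C -> C) (z l : C) :
  is_Cderive f z l <->
  is_derive (K := C_AbsRing) (V := AbsRing_NormedModule C_AbsRing) f z l.
Proof.
split; intros [_ H]; (split; [apply is_linear_scal_l|exact H]).
Qed.

Lemma ex_Cderive_mult (f g : C -> C) (z : C) :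
  ex_Cderive f z -> ex_Cderive g z -> ex_Cderive (fun s => f s * g s) z.
Proof.
intros [df Hf] [dg Hg]; eexists.
apply is_Cderive_AbsRing in Hf; apply is_Cderive_AbsRing in Hg.
apply is_Cderive_AbsRing.
exact (is_derive_mult (K := C_AbsRing) f g z df dg Hf Hg Cmult_comm).
Qed.

Lemma ex_Cderive_minus (f g : C -> C) (z : C) :
  ex_Cderive f z -> ex_Cderive g z -> ex_Cderive (fun s => f s - g s) z.
Proof. exact (ex_derive_minus (K := C_AbsRing) (V := C_NormedModule) f g z). Qed.

Lemma ex_Cderive_const (c z : C) : ex_Cderive (fun _ => c) z.
Proof. exact (ex_derive_const (K := C_AbsRing) (V := C_NormedModule) c z). Qed.

Lemma ex_Cderive_id (z : C) : ex_Cderive (fun s => s) z.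
Proof. eexists; apply is_Cderive_AbsRing, is_derive_id. Qed.

Lemma ex_Cderive_comp (f g : C -> C) (z : C) :
  ex_Cderive f (g z) -> ex_Cderive g z -> ex_Cderive (fun s => f (g s)) z.
Proof.
intros [df Hf] [dg Hg]; apply is_Cderive_AbsRing in Hg; eexists.
exact (is_derive_comp (K := C_AbsRing) (V := C_NormedModule) f g z df dg Hf Hg).
Qed.

Lemma ex_Cderive_shift (f : C -> C) (c z : C) :
  ex_Cderive f (z - c) -> ex_Cderive (fun s => f (s - c)) z.
Proof.
intros Hf; apply (ex_Cderive_comp f (fun s => s - c)); [exact Hf|].
apply ex_Cderive_minus; [apply ex_Cderive_id|apply ex_Cderive_const].
Qed.

Lemma locally_neq (z w : C) :
  z <> w -> locally (T := C_UniformSpace) z (fun s => s <> w).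
Proof.
intros Hzw; apply locally_C.
assert (Hd : (0 < Cmod (w - z)%C)%R).
{ apply Cmod_gt_0; intros H; apply Hzw.
  replace w with (z + (w - z)) by ring; rewrite H; ring. }
exists (mkposreal _ Hd); intros y Hy Hyw; subst y.
change (Cmod (w - z)%C < Cmod (w - z)%C)%R in Hy; lra.
Qed.

(** * Taylor remainders of the exponential *)

Lemma Cexp_0 : Cexp 0 = 1.
Proof.
unfold Cexp; simpl; rewrite exp_0, cos_0, sin_0; apply injective_projections; simpl; ring.
Qed.

Lemma Cexp_plus (x y : C) : Cexp (x + y) = Cexp x * Cexp y.
Proof.
unfold Cexp; destruct x as [a b], y as [c d]; simpl.
rewrite exp_plus, cos_plus, sin_plus.
apply injective_projections; simpl; ring.
Qed.

Lemma Cexp_opp (x : C) : Cexp (- x) = / Cexp x.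
Proof.
assert (H : Cexp (- x) * Cexp x = 1).
{ rewrite <- Cexp_plus, <- Cexp_0; f_equal; ring. }
assert (Hx : Cexp x <> 0).
{ intros H0; rewrite H0, Cmult_0_r in H; apply C1_nz; symmetry; exact H. }
rewrite <- (Cmult_1_l (/ Cexp x)), <- H; field; exact Hx.
Qed.

Lemma Cmod_Cexp (z : C) : Cmod (Cexp z) = exp (Re z).
Proof.
unfold Cmod, Cexp; cbn [fst snd].
replace (_ + _)%R with (exp (Re z) ^ 2)%R.
- apply sqrt_pow2, Rlt_le, exp_pos.
- pose proof (sin2_cos2 (Im z)) as H; unfold Rsqr in H.
  replace (exp (Re z) ^ 2)%R with
    (exp (Re z) ^ 2 * (sin (Im z) * sin (Im z) + cos (Im z) * cos (Im z)))%R
    by (rewrite H; ring).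
  ring.
Qed.

Lemma exp_le (x y : R) : (x <= y)%R -> (exp x <= exp y)%R.
Proof. intros [H|H]; [left; apply exp_increasing, H|subst; apply Rle_refl]. Qed.

Lemma Cmod_Cexp_le (z : C) : (Cmod (Cexp z) <= exp (Cmod z))%R.
Proof.
rewrite Cmod_Cexp; apply exp_le.
eapply Rle_trans; [apply Rle_abs|apply re_le_Cmod].
Qed.

(** The mean value theorem fails for complex-valued functions, so it is used on real and imaginary
    parts separately. *)
Lemma MVT_bound_01 (f df : R -> R) (K : R) :
  (forall t, is_derive f t (df t)) ->
  (forall t, (0 <= t <= 1)%R -> (Rabs (df t) <= K)%R) ->
  (Rabs (f 1 - f 0) <= K)%R.
Proof.
intros Hf HK.
destruct (MVT_gen f 0 1 df) as [c [Hc E]].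
- intros; apply Hf.
- intros x _; apply derivable_continuous_pt; exists (df x).
  apply is_derive_Reals, Hf.
- rewrite Rmin_left, Rmax_right in Hc by lra.
  rewrite E, Rminus_0_r, Rmult_1_r; apply HK, Hc.
Qed.

(* One integration along the segment from 0 to u raises the order of vanishing by one. *)
Lemma Cmod_le_of_ray_derivative (f g : C -> C) (K : R) (k : nat) :
  (0 <= K)%R -> f 0 = 0 ->
  (forall (u : C) (t : R), is_derive (fun x : R => Re (f (x * u))) t (Re (u * g (t * u)))) ->
  (forall (u : C) (t : R), is_derive (fun x : R => Im (f (x * u))) t (Im (u * g (t * u)))) ->
  (forall u, (Cmod (g u) <= K * Cmod u ^ k * exp (Cmod u))%R) ->
  forall u, (Cmod (f u) <= 2 * K * Cmod u ^ S k * exp (Cmod u))%R.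
Proof.
intros HK f0 HR HI Hg u.
(* The derivative along the segment is u g(t u): its factor u raises the power from k to k + 1, and
   |t u| <= |u| makes the bound uniform in t. *)
assert (B : forall t : R, (0 <= t <= 1)%R ->
  (Cmod (u * g (t * u))%C <= K * Cmod u ^ S k * exp (Cmod u))%R).
{ intros t Ht; rewrite Cmod_mult.
  pose proof (Cmod_ge_0 u).
  replace (K * Cmod u ^ S k * exp (Cmod u))%R
    with (Cmod u * (K * Cmod u ^ k * exp (Cmod u)))%R by (simpl; ring).
  apply Rmult_le_compat_l; [assumption|].
  assert (Htu : (0 <= Cmod (t * u)%C <= Cmod u)%R).
  { split; [apply Cmod_ge_0|]; rewrite Cmod_mult, Cmod_R, Rabs_pos_eq by lra; nra. }
  eapply Rle_trans; [apply Hg|].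
  apply Rmult_le_compat; [|left; apply exp_pos| |apply exp_le, Htu].
  - apply Rmult_le_pos; [assumption|apply pow_le, Htu].
  - apply Rmult_le_compat_l; [assumption|apply pow_incr, Htu]. }
assert (E0 : f (RtoC 0 * u) = 0) by (rewrite Cmult_0_l; exact f0).
assert (E1 : f (RtoC 1 * u) = f u) by (rewrite Cmult_1_l; reflexivity).
assert (HRe : (Rabs (Re (f u)) <= K * Cmod u ^ S k * exp (Cmod u))%R).
{ pose proof (MVT_bound_01 _ _ (K * Cmod u ^ S k * exp (Cmod u))%R (HR u)) as H.
  cbv beta in H; rewrite E0, E1 in H; change (Re (RtoC 0)) with 0%R in H; rewrite Rminus_0_r in H.
  apply H; intros t Ht; eapply Rle_trans; [apply re_le_Cmod|apply B, Ht]. }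
assert (HIm : (Rabs (Im (f u)) <= K * Cmod u ^ S k * exp (Cmod u))%R).
{ pose proof (MVT_bound_01 _ _ (K * Cmod u ^ S k * exp (Cmod u))%R (HI u)) as H.
  cbv beta in H; rewrite E0, E1 in H; change (Im (RtoC 0)) with 0%R in H; rewrite Rminus_0_r in H.
  apply H; intros t Ht; eapply Rle_trans; [|apply B, Ht].
  eapply Rle_trans; [apply Rmax_r|apply Rmax_Cmod]. }
(* Adding the bounds for the real and imaginary parts produces the factor 2. *)
replace (f u) with (RtoC (Re (f u)) + Ci * RtoC (Im (f u)))
  by (unfold Re, Im; apply injective_projections; simpl; ring).
eapply Rle_trans; [apply Cmod_triangle|].
rewrite Cmod_mult, Cmod_Ci, !Cmod_R; lra.
Qed.

(** First of three successive integrations starting from |exp u| <= exp |u|. Each one uses the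
    preceding remainder as derivative and doubles the constant: 2, 4, 8. *)
Lemma Cmod_Cexp_minus1_le (u : C) :
  (Cmod (Cexp u - 1)%C <= 2 * Cmod u ^ 1 * exp (Cmod u))%R.
Proof.
pose proof (Cmod_le_of_ray_derivative (fun u => Cexp u - 1) Cexp 1 0) as H.
rewrite Rmult_1_r in H; apply H; clear H.
- lra.
- rewrite Cexp_0; ring.
- intros v t; unfold Cexp; simpl; auto_derive; [easy|unfold Rminus; ring].
- intros v t; unfold Cexp; simpl; auto_derive; [easy|unfold Rminus; ring].
- intros v; simpl; rewrite Rmult_1_r, Rmult_1_l; apply Cmod_Cexp_le.
Qed.

Lemma Cmod_Cexp_Taylor1_le (u : C) :
  (Cmod (Cexp u - 1 - u)%C <= 4 * Cmod u ^ 2 * exp (Cmod u))%R.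
Proof.
pose proof (Cmod_le_of_ray_derivative (fun u => Cexp u - 1 - u) (fun u => Cexp u - 1) 2 1) as H.
replace (2 * 2)%R with 4%R in H by ring; apply H; clear H.
- lra.
- rewrite Cexp_0; ring.
- intros v t; unfold Cexp; simpl; auto_derive; [easy|unfold Rminus; ring].
- intros v t; unfold Cexp; simpl; auto_derive; [easy|unfold Rminus; ring].
- apply Cmod_Cexp_minus1_le.
Qed.

Lemma Cmod_Cexp_Taylor2_le (u : C) :
  (Cmod (Cexp u - 1 - u - RtoC (/ 2) * u * u)%C <= 8 * Cmod u ^ 3 * exp (Cmod u))%R.
Proof.
pose proof (Cmod_le_of_ray_derivative
  (fun u => Cexp u - 1 - u - RtoC (/ 2) * u * u) (fun u => Cexp u - 1 - u) 4 2) as H.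
replace (2 * 4)%R with 8%R in H by ring; apply H; clear H.
- lra.
- rewrite Cexp_0; ring.
- intros v t; unfold Cexp; simpl; auto_derive; [easy|unfold Rminus; field].
- intros v t; unfold Cexp; simpl; auto_derive; [easy|unfold Rminus; field].
- apply Cmod_Cexp_Taylor1_le.
Qed.

(** * Complex series *)

Lemma ex_Cseries_le (x : nat -> C) (b : nat -> R) :
  (forall n, (Cmod (x n) <= b n)%R) -> ex_series b -> ex_Cseries x.
Proof.
intros H; apply (ex_series_le (K := C_AbsRing) (V := C_CompleteNormedModule) x b).
intros n; change (norm (x n)) with (Cmod (x n)); apply H.
Qed.

Lemma CSeries_correct (x : nat -> C) : ex_Cseries x -> is_Cseries x (CSeries x).
Proof. intros [l Hl]; rewrite (CSeries_unique x l Hl); exact Hl. Qed.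

Lemma CSeries_ext (x y : nat -> C) : (forall n, x n = y n) -> CSeries x = CSeries y.
Proof.
intros H; unfold CSeries; f_equal; apply Series_ext; intros n; rewrite H; reflexivity.
Qed.

Lemma ex_Cseries_plus (x y : nat -> C) :
  ex_Cseries x -> ex_Cseries y -> ex_Cseries (fun n => x n + y n).
Proof. exact (ex_series_plus (K := C_AbsRing) (V := C_NormedModule) x y). Qed.

Lemma ex_Cseries_scal (k : C) (x : nat -> C) :
  ex_Cseries x -> ex_Cseries (fun n => k * x n).
Proof. exact (ex_series_scal (K := C_AbsRing) (V := C_NormedModule) k x). Qed.

Lemma CSeries_plus (x y : nat -> C) :
  ex_Cseries x -> ex_Cseries y ->
  CSeries (fun n => x n + y n) = CSeries x + CSeries y.
Proof.
intros Hx Hy; apply CSeries_unique.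
exact (is_series_plus x y _ _ (CSeries_correct x Hx) (CSeries_correct y Hy)).
Qed.

Lemma CSeries_scal (k : C) (x : nat -> C) :
  ex_Cseries x -> CSeries (fun n => k * x n) = k * CSeries x.
Proof.
intros Hx; apply CSeries_unique.
exact (is_series_scal k x _ (CSeries_correct x Hx)).
Qed.

(** The triangle inequality for partial sums passes to the limit, the norm being continuous. *)
Lemma Cmod_CSeries_le (x : nat -> C) (b : nat -> R) :
  (forall n, (Cmod (x n) <= b n)%R) -> ex_series b ->
  (Cmod (CSeries x) <= Series b)%R.
Proof.
intros H Hb.
pose proof (CSeries_correct x (ex_Cseries_le x b H Hb)) as Hx.
pose proof (filterlim_comp _ _ _ _ _ _ _ _ Hx
  (filterlim_norm (K := C_AbsRing) (V := C_NormedModule) (CSeries x))) as Hn.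
change (Rbar_le (Cmod (CSeries x)) (Series b)).
apply is_lim_seq_le with
  (u := fun n => Cmod (sum_n (G := C_AbelianMonoid) x n)) (v := sum_n b).
- intros n.
  eapply Rle_trans; [exact (norm_sum_n_m (K := C_AbsRing) (V := C_NormedModule) x 0 n)|].
  apply (sum_n_m_le _ b); intros k; apply H.
- exact Hn.
- exact (Series_correct b Hb).
Qed.

(** * Dirichlet series *)

(** Absorbs the powers of [l n] created by differentiation into the exponential weight of
    [c_decay]. *)
Lemma pow_le_exp (x : R) (k : nat) : (0 <= x)%R -> (x ^ k <= exp (INR k * x))%R.
Proof.
intros Hx; induction k as [|k IH].
- simpl; rewrite Rmult_0_l, exp_0; lra.
- rewrite S_INR; replace ((INR k + 1) * x)%R with (x + INR k * x)%R by ring.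
  rewrite exp_plus; simpl.
  apply Rmult_le_compat; [assumption|apply pow_le, Hx| |exact IH].
  pose proof (exp_ineq1_le x); lra.
Qed.

Section DirichletSeries.

Variables (c : nat -> C) (l : nat -> R).
Hypothesis l_ge0 : forall n, (0 <= l n)%R.
Hypothesis c_decay : forall K : R, ex_series (fun n => Cmod (c n) * exp (K * l n))%R.

(** A general Dirichlet series with exponents [l n]. Since [c_decay] holds for every K, it converges
    absolutely at every s. *)
Definition Dirichlet (s : C) : C := CSeries (fun n => c n * Cexp (- (s * RtoC (l n)))).

Lemma ex_Cseries_exp_bound (x : nat -> C) (A K : R) :
  (forall n, (Cmod (x n) <= A * (Cmod (c n) * exp (K * l n)))%R) -> ex_Cseries x.
Proof.
intros H; eapply ex_Cseries_le; [exact H|].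
exact (ex_series_scal (K := R_AbsRing) (V := R_NormedModule) A _ (c_decay K)).
Qed.

Lemma Cmod_CSeries_exp_bound (x : nat -> C) (A K : R) :
  (forall n, (Cmod (x n) <= A * (Cmod (c n) * exp (K * l n)))%R) ->
  (Cmod (CSeries x) <= A * Series (fun n => Cmod (c n) * exp (K * l n)))%R.
Proof.
intros H; rewrite <- Series_scal_l; apply Cmod_CSeries_le; [exact H|].
exact (ex_series_scal (K := R_AbsRing) (V := R_NormedModule) A _ (c_decay K)).
Qed.

Lemma Cmod_opp_mult_l (u : C) (n : nat) : Cmod (- (u * RtoC (l n))) = (Cmod u * l n)%R.
Proof.
rewrite Cmod_opp, Cmod_mult, Cmod_R, Rabs_pos_eq; [reflexivity|apply l_ge0].
Qed.

(** Up to sign these are the terms of the k-th termwise derivative at s; each is bounded by |c_n|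
    exp((k + |s|) l_n). *)
Lemma ex_Cseries_moment (s : C) (k : nat) :
  ex_Cseries (fun n => RtoC (l n) ^ k * (c n * Cexp (- (s * RtoC (l n))))).
Proof.
apply ex_Cseries_exp_bound with (A := 1%R) (K := (INR k + Cmod s)%R); intros n.
rewrite Rmult_1_l, !Cmod_mult, Cmod_pow, Cmod_R, Rabs_pos_eq by apply l_ge0.
replace ((INR k + Cmod s) * l n)%R with (INR k * l n + Cmod s * l n)%R by ring.
rewrite exp_plus.
pose proof (pow_le_exp (l n) k (l_ge0 n)) as H1.
pose proof (Cmod_Cexp_le (- (s * RtoC (l n)))) as H2; rewrite Cmod_opp_mult_l in H2.
rewrite <- Rmult_assoc, (Rmult_comm _ (Cmod (c n))), Rmult_assoc.
apply Rmult_le_compat_l; [apply Cmod_ge_0|].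
apply Rmult_le_compat; [apply pow_le, l_ge0|apply Cmod_ge_0|exact H1|exact H2].
Qed.

Lemma ex_Cseries_Dirichlet (s : C) :
  ex_Cseries (fun n => c n * Cexp (- (s * RtoC (l n)))).
Proof.
eapply (ex_series_ext (K := C_AbsRing)); [|apply (ex_Cseries_moment s 0)].
intros n; simpl; ring.
Qed.

(** In the weight, |s| pays for exp(-s l_n), k for the factor l_n^k, and 1 for exp(|u| l_n) with |u|
    <= 1. The power |u|^k is left outside, so it can be taken out of the sum. *)
Lemma remainder_le (r : C -> C) (A : R) (k n : nat) (s u : C) :
  (0 <= A)%R -> (Cmod u <= 1)%R ->
  (Cmod (r (- (u * RtoC (l n)))%C) <=
     A * Cmod (- (u * RtoC (l n)))%C ^ k * exp (Cmod (- (u * RtoC (l n)))%C))%R ->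
  (Cmod (c n * Cexp (- (s * RtoC (l n))) * r (- (u * RtoC (l n))))%C <=
     A * Cmod u ^ k * (Cmod (c n) * exp ((Cmod s + INR k + 1) * l n)))%R.
Proof.
intros HA Hu Hr; rewrite Cmod_opp_mult_l in Hr.
pose proof (Cmod_Cexp_le (- (s * RtoC (l n)))) as H2; rewrite Cmod_opp_mult_l in H2.
rewrite !Cmod_mult.
replace ((Cmod s + INR k + 1) * l n)%R
  with (Cmod s * l n + (INR k * l n + 1 * l n))%R by ring.
rewrite !exp_plus.
replace (A * Cmod u ^ k *
  (Cmod (c n) * (exp (Cmod s * l n) * (exp (INR k * l n) * exp (1 * l n)))))%R
  with (Cmod (c n) * exp (Cmod s * l n) *
         (A * (Cmod u ^ k * exp (INR k * l n)) * exp (1 * l n)))%R by ring.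
apply Rmult_le_compat.
- apply Rmult_le_pos; apply Cmod_ge_0.
- apply Cmod_ge_0.
- apply Rmult_le_compat_l; [apply Cmod_ge_0|exact H2].
- eapply Rle_trans; [exact Hr|].
  pose proof (Cmod_ge_0 u) as Hu0; pose proof (l_ge0 n) as Hl.
  apply Rmult_le_compat.
  + apply Rmult_le_pos; [assumption|apply pow_le, Rmult_le_pos; assumption].
  + left; apply exp_pos.
  + apply Rmult_le_compat_l; [assumption|].
    rewrite Rpow_mult_distr; apply Rmult_le_compat_l; [apply pow_le, Hu0|].
    apply pow_le_exp, Hl.
  + apply exp_le, Rmult_le_compat_r; assumption.
Qed.

(** The derivative is the termwise one. As exp(-(s + u) l_n) factors, the n-th term of the remainder
    is [e n] times the first-order Taylor remainder of exp at -u l_n, hence quadratic in u with a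
    summable constant. *)
Lemma ex_Cderive_Dirichlet (s : C) : ex_Cderive Dirichlet s.
Proof.
set (e := fun n => c n * Cexp (- (s * RtoC (l n)))).
exists (CSeries (fun n => - (1) * (RtoC (l n) ^ 1 * e n))).
eapply is_Cderive_quadratic with (d := 1%R)
  (K := (4 * Series (fun n => Cmod (c n) * exp ((Cmod s + INR 2 + 1) * l n)))%R); [lra|].
intros u Hu.
assert (E : Dirichlet (s + u) - Dirichlet s - u * CSeries (fun n => - (1) * (RtoC (l n) ^ 1 * e n))
  = CSeries (fun n => e n * (Cexp (- (u * RtoC (l n))) - 1 - - (u * RtoC (l n))))).
{ transitivity (CSeries (fun n => c n * Cexp (- ((s + u) * RtoC (l n)))
    + (- (1) * e n + u * (RtoC (l n) ^ 1 * e n)))).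
  - rewrite !CSeries_plus, !CSeries_scal; repeat first
      [apply ex_Cseries_Dirichlet | apply ex_Cseries_moment | apply ex_Cseries_plus
      | apply ex_Cseries_scal].
    unfold Dirichlet; fold e; ring.
  - apply CSeries_ext; intros n; unfold e.
    replace (- ((s + u) * RtoC (l n))) with (- (s * RtoC (l n)) + - (u * RtoC (l n))) by ring.
    rewrite Cexp_plus; ring. }
rewrite E.
eapply Rle_trans.
- apply Cmod_CSeries_exp_bound; intros n.
  apply (remainder_le (fun v => Cexp v - 1 - v) 4 2 n s u);
    [lra|lra|apply Cmod_Cexp_Taylor1_le].
- right; ring.
Qed.

(** One order more than differentiability: after division by u the cubic error becomes the quadratic
    one needed to differentiate the slope at 0. *)
Lemma Dirichlet_Taylor2_0 :
  exists (A M : C) (K : R), forall u, (Cmod u < 1)%R ->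
    (Cmod (Dirichlet u - Dirichlet 0 - u * A - u * u * M)%C <= K * Cmod u ^ 3)%R.
Proof.
(* Here [e n] is just [c n]; the trivial exponential is kept so that [ex_Cseries_moment] applies
   with s = 0. *)
set (e := fun n => c n * Cexp (- (0 * RtoC (l n)))).
exists (CSeries (fun n => - (1) * (RtoC (l n) ^ 1 * e n))).
exists (CSeries (fun n => RtoC (/ 2) * (RtoC (l n) ^ 2 * e n))).
exists (8 * Series (fun n => Cmod (c n) * exp ((Cmod 0 + INR 3 + 1) * l n)))%R.
intros u Hu.
replace (_ - _ - _ - _) with (CSeries (fun n => e n * (Cexp (- (u * RtoC (l n))) - 1
  - - (u * RtoC (l n)) - RtoC (/ 2) * - (u * RtoC (l n)) * - (u * RtoC (l n))))).
- eapply Rle_trans.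
  + apply Cmod_CSeries_exp_bound; intros n.
    apply (remainder_le (fun v => Cexp v - 1 - v - RtoC (/ 2) * v * v) 8 3 n 0 u);
      [lra|lra|apply Cmod_Cexp_Taylor2_le].
  + right; ring.
- symmetry; transitivity (CSeries (fun n => c n * Cexp (- (u * RtoC (l n)))
    + (- (1) * e n + (u * (RtoC (l n) ^ 1 * e n)
    + - (RtoC (/ 2) * u * u) * (RtoC (l n) ^ 2 * e n))))).
  + rewrite !CSeries_plus, !CSeries_scal; repeat first
      [apply ex_Cseries_Dirichlet | apply ex_Cseries_moment | apply ex_Cseries_plus
      | apply ex_Cseries_scal].
    unfold Dirichlet; fold e; ring.
  + apply CSeries_ext; intros n; unfold e.
    replace (- (0 * RtoC (l n))) with (RtoC 0) by ring.
    rewrite Cexp_0; ring.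
Qed.

End DirichletSeries.

(** * Removing the singularity of the slope at 0 *)

(** The value A at 0 fills the gap, and dividing the cubic bound by u shows that the extension has
    derivative M there. *)
Lemma slope_extends (f : C -> C) (A M : C) (K : R) :
  (forall s : C, ex_Cderive f s) ->
  (forall u, (Cmod u < 1)%R ->
    (Cmod (f u - f 0 - u * A - u * u * M)%C <= K * Cmod u ^ 3)%R) ->
  exists g : C -> C, (forall s : C, s <> 0 -> g s = (f s - f 0) / s) /\
    (forall s : C, ex_Cderive g s).
Proof.
intros Hf HK.
set (g := fun s => if Ceq_dec s 0 then A else (f s - f 0) / s).
assert (g0 : g 0 = A) by (unfold g; destruct (Ceq_dec 0 0); [reflexivity|congruence]).
assert (gE : forall s : C, s <> 0 -> g s = (f s - f 0) / s)
  by (intros s Hs; unfold g; destruct (Ceq_dec s 0); [contradiction|reflexivity]).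
exists g; split; [exact gE|]; intros s.
destruct (Ceq_dec s 0) as [->|Hs].
- exists M; apply is_Cderive_quadratic with (K := K) (d := 1%R); [lra|].
  intros u Hu; rewrite Cplus_0_l, g0.
  destruct (Ceq_dec u 0) as [->|Hu0].
  + rewrite g0; replace (A - A - 0 * M) with (RtoC 0) by ring.
    rewrite Cmod_0; simpl; lra.
  + rewrite (gE u Hu0).
    pose proof (proj1 (Cmod_gt_0 u) Hu0) as Hm.
    replace (_ - _ - _) with ((f u - f 0 - u * A - u * u * M) / u) by (field; exact Hu0).
    rewrite Cmod_div by exact Hu0.
    apply Rmult_le_reg_r with (1 := Hm).
    unfold Rdiv; rewrite Rmult_assoc, Rinv_l, Rmult_1_r by lra.
    replace (K * Cmod u ^ 2 * Cmod u)%R with (K * Cmod u ^ 3)%R by ring.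
    apply HK, Hu.
- apply (ex_derive_ext_loc (K := C_AbsRing) (fun s => (f s - f 0) * / s)).
  + apply locally_C; generalize (locally_neq s 0 Hs); apply filter_imp.
    intros t Ht; symmetry; apply gE, Ht.
  + apply ex_Cderive_mult; [|apply ex_Cderive_inv, Hs].
    apply ex_Cderive_minus; [apply Hf|apply ex_Cderive_const].
Qed.

(* The junk value of [ln] outside its domain. *)
Lemma ln_INR_0 : ln (INR 0) = 0%R.
Proof.
unfold ln; destruct (Rlt_dec 0 (INR 0)) as [H|H]; [exfalso; simpl in H; lra|reflexivity].
Qed.

Lemma ln_INR_ge0 (n : nat) : (0 <= ln (INR n))%R.
Proof.
destruct n as [|n].
- rewrite ln_INR_0; apply Rle_refl.
- rewrite <- ln_1; apply ln_le; [lra|].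
  rewrite S_INR; pose proof (pos_INR n); lra.
Qed.

Lemma sum_n_single (x : nat -> C) (N k : nat) :
  (forall n, (n <= N)%nat -> n <> k -> x n = 0) -> (k <= N)%nat ->
  sum_n (G := C_AbelianMonoid) x N = x k.
Proof.
induction N as [|N IH]; intros Hx Hk.
- rewrite sum_O; f_equal; lia.
- rewrite sum_Sn; destruct (Nat.eq_dec k (S N)) as [->|Hne].
  + rewrite (sum_n_ext_loc (G := C_AbelianMonoid) x (fun _ => zero)) by (intros; apply Hx; lia).
    unfold sum_n; rewrite sum_n_m_const_zero; apply Cplus_0_l.
  + rewrite IH, (Hx (S N)) by (intros; try apply Hx; lia); apply Cplus_0_r.
Qed.

(** * Powers of w along a residue class *)

Section TwistedPartialZeta.

Variables (w : C) (a f : nat).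
Hypotheses (w_neq0 : w <> 0) (w_lt1 : (Cmod w < 1)%R).
Hypotheses (a_gt0 : (0 < a)%nat) (a_lt_f : (a < f)%nat).

Definition class_power (n : nat) : C := if in_class a f n then w ^ n else 0.

Lemma Cmod_class_power_le (n : nat) : (Cmod (class_power n) <= Cmod w ^ n)%R.
Proof.
unfold class_power; destruct (in_class a f n).
- rewrite Cmod_pow; apply Rle_refl.
- rewrite Cmod_0; apply pow_le, Cmod_ge_0.
Qed.

(* For every [d > 0] the concavity of [ln] gives [K ln n <= d n + const], so the factor
   [n ^ K] only costs a slightly larger ratio of the geometric series. *)
Lemma class_power_decay (K : R) :
  ex_series (fun n => Cmod (class_power n) * exp (K * ln (INR n)))%R.
Proof.
pose proof (proj1 (Cmod_gt_0 w) w_neq0) as r_gt0.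
(* [rho] is the midpoint of r and 1; with d = ln(rho / r) below, r exp(d) = rho is still a
   convergent ratio. *)
set (r := Cmod w) in *; set (rho := ((1 + r) / 2)%R).
assert (Hrho : (r < rho < 1)%R) by (unfold rho; lra).
set (d := ln (rho / r)).
assert (Hd : (0 < d)%R).
{ unfold d; rewrite <- ln_1; apply ln_increasing; [lra|].
  apply Rmult_lt_reg_r with r; [assumption|]; unfold Rdiv.
  rewrite Rmult_assoc, Rinv_l by lra; lra. }
set (K' := (Rabs K + 1)%R).
assert (HK' : (0 < K')%R) by (unfold K'; pose proof (Rabs_pos K); lra).
(* From ln x <= x - 1 at x = (d / K') n comes K' ln n <= d n + B. Using |B| also covers n = 0, where
   the logarithm is 0. *)
set (B := (- K' * ln (d / K'))%R).
apply (ex_series_le (K := R_AbsRing) (V := R_CompleteNormedModule) _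
  (fun n => exp (Rabs B) * rho ^ n)%R).
2:{ apply (ex_series_scal (K := R_AbsRing) (V := R_NormedModule) (exp (Rabs B))).
    apply ex_series_geom; rewrite Rabs_pos_eq; lra. }
intros n.
change (Rabs (Cmod (class_power n) * exp (K * ln (INR n))) <= exp (Rabs B) * rho ^ n)%R.
rewrite Rabs_pos_eq by (apply Rmult_le_pos; [apply Cmod_ge_0|left; apply exp_pos]).
assert (Hln : (K * ln (INR n) <= Rabs B + d * INR n)%R).
{ apply Rle_trans with (K' * ln (INR n))%R.
  { apply Rmult_le_compat_r; [apply ln_INR_ge0|]; unfold K'; pose proof (Rle_abs K); lra. }
  destruct n as [|n].
  { rewrite ln_INR_0; simpl; pose proof (Rabs_pos B); lra. }
  assert (Hn : (0 < INR (S n))%R) by (apply lt_0_INR; lia).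
  assert (Hdk : (0 < d / K')%R) by (apply Rdiv_lt_0_compat; assumption).
  assert (H1 : (ln (d / K') + ln (INR (S n)) <= d / K' * INR (S n))%R).
  { rewrite <- ln_mult by assumption.
    pose proof (exp_ineq1_le (ln (d / K' * INR (S n)))) as H.
    rewrite exp_ln in H by (apply Rmult_lt_0_compat; assumption); lra. }
  apply Rmult_le_compat_l with (r := K') in H1; [|lra].
  replace (K' * (d / K' * INR (S n)))%R with (d * INR (S n))%R in H1 by (field; lra).
  pose proof (Rle_abs B); unfold B in *; lra. }
apply Rle_trans with (r ^ n * (exp (Rabs B) * exp d ^ n))%R.
- apply Rmult_le_compat; [apply Cmod_ge_0|left; apply exp_pos|apply Cmod_class_power_le|].
  replace (exp d ^ n)%R with (exp (d * INR n)).
  + rewrite <- exp_plus; apply exp_le, Hln.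
  + rewrite Rmult_comm; clear; induction n as [|n IH].
    * simpl; rewrite Rmult_0_l, exp_0; reflexivity.
    * rewrite S_INR; replace ((INR n + 1) * d)%R with (d + INR n * d)%R by ring.
      rewrite exp_plus, IH; reflexivity.
- replace rho with (r * exp d)%R at 1.
  + rewrite Rpow_mult_distr; right; ring.
  + unfold d; rewrite exp_ln; [field; lra|]; apply Rdiv_lt_0_compat; lra.
Qed.

Lemma class_power_shift (k : nat) : class_power (f + k) = w ^ f * class_power k.
Proof.
unfold class_power, in_class.
replace ((f + k) mod f) with (k mod f).
2:{ rewrite <- (Nat.Div0.mod_add k 1 f); f_equal; lia. }
replace (Nat.ltb 0 (f + k)) with true by (symmetry; apply Nat.ltb_lt; lia).
(* At k = 0 the positivity test treats f and 0 differently, but both terms vanish: 0 < a < f puts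
   the multiples of f outside the class. *)
destruct k as [|k].
- rewrite Nat.Div0.mod_0_l, (Nat.mod_small a f) by assumption.
  replace (Nat.eqb 0 a) with false by (symmetry; apply Nat.eqb_neq; lia).
  simpl; ring.
- simpl Nat.ltb; simpl andb.
  destruct (Nat.eqb (S k mod f) (a mod f)); [apply Cpow_add_r|ring].
Qed.

Lemma class_power_small (n : nat) : (n < f)%nat -> n <> a -> class_power n = 0.
Proof.
intros Hn Hna; unfold class_power, in_class.
rewrite !Nat.mod_small by lia.
replace (Nat.eqb n a) with false by (symmetry; apply Nat.eqb_neq; exact Hna).
rewrite Bool.andb_false_r; reflexivity.
Qed.

Lemma class_power_self : class_power a = w ^ a.
Proof.
unfold class_power, in_class; rewrite Nat.eqb_refl.
replace (Nat.ltb 0 a) with true by (symmetry; apply Nat.ltb_lt; assumption).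
reflexivity.
Qed.

Lemma ex_Cseries_class_power : ex_Cseries class_power.
Proof.
apply ex_Cseries_le with (b := fun n => (Cmod w ^ n)%R); [apply Cmod_class_power_le|].
apply ex_series_geom; rewrite Rabs_pos_eq; [assumption|apply Cmod_ge_0].
Qed.

Lemma w_pow_neq1 : w ^ f - 1 <> 0.
Proof.
intros H.
assert (E : w ^ f = 1) by (rewrite <- (Cplus_0_l 1), <- H; ring).
apply (f_equal Cmod) in E; rewrite Cmod_pow, Cmod_1 in E.
pose proof (pow_lt_1_compat (Cmod w) f (conj (Cmod_ge_0 w) w_lt1) ltac:(lia)); lra.
Qed.

(** Self-similarity determines the sum S: multiplying by w^f shifts the series by one period, which
    drops only the term w^a, so w^f S = S - w^a. *)
Lemma CSeries_class_power : CSeries class_power = - (w ^ a / (w ^ f - 1)).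
Proof.
set (S := CSeries class_power).
assert (E : w ^ f * S = S - w ^ a).
{ unfold S at 1; rewrite <- CSeries_scal by apply ex_Cseries_class_power.
  apply CSeries_unique.
  apply (is_series_ext (K := C_AbsRing) (V := C_NormedModule) (fun k => class_power (f + k))).
  { intros k; apply class_power_shift. }
  apply (is_series_incr_n (K := C_AbsRing) (V := C_NormedModule)); [lia|].
  change (sum_n (G := NormedModule.AbelianMonoid C_AbsRing C_NormedModule))
    with (sum_n (G := C_AbelianMonoid)).
  (* The dropped indices 0, ..., [pred f] are exactly those below f, and only n = a contributes. *)
  rewrite (sum_n_single class_power (Init.Nat.pred f) a), class_power_self
    by (intros; try apply class_power_small; lia).
  change (is_Cseries class_power (S - w ^ a + w ^ a)).
  replace (S - w ^ a + w ^ a) with S by ring.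
  apply CSeries_correct, ex_Cseries_class_power. }
pose proof w_pow_neq1.
replace (w ^ a) with (S - w ^ f * S) by (rewrite E; ring).
field; assumption.
Qed.

Lemma Dirichlet_class_power_0 :
  Dirichlet class_power (fun n => ln (INR n)) 0 = - (w ^ a / (w ^ f - 1)).
Proof.
rewrite <- CSeries_class_power; apply CSeries_ext; intros n.
rewrite Cmult_0_l; replace (- 0) with (RtoC 0) by ring.
rewrite Cexp_0; apply Cmult_1_r.
Qed.

End TwistedPartialZeta.

(** * The partial zeta function and its pole at 1 *)

(** The twist and the power of q merge as q^(n h) xi^n = (q^h xi)^n, and 1 / n^s is exp(-s ln n). *)
Lemma partial_sum_Dirichlet (q xi : C) (h a f : nat) (s : C) :
  partial_sum q xi h a f s =
  Dirichlet (class_power (q ^ h * xi) a f) (fun n => ln (INR n)) s.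
Proof.
apply CSeries_ext; intros n; unfold class_power.
destruct (in_class a f n); [|ring].
rewrite Cpow_mult_l, Nat.mul_comm, Cpow_mult_r, Cexp_opp; reflexivity.
Qed.

Lemma root_of_unity_Cmod (xi : C) (r : nat) : (0 < r)%nat -> xi ^ r = 1 -> Cmod xi = 1%R.
Proof.
intros Hr E; apply (f_equal Cmod) in E; rewrite Cmod_pow, Cmod_1 in E.
pose proof (Cmod_ge_0 xi) as H0.
destruct (Rtotal_order (Cmod xi) 1) as [H|[H|H]]; [|exact H|].
- pose proof (pow_lt_1_compat (Cmod xi) r (conj H0 H) ltac:(lia)); lra.
- pose proof (Rlt_pow_R1 (Cmod xi) r H Hr); lra.
Qed.

Lemma entire_holomorphic_at (g : C -> C) (z : C) :
  (forall s : C, ex_Cderive g s) -> holomorphic_at g z.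
Proof. intros H; apply (filter_forall (F := locally (T := C_UniformSpace) z)), H. Qed.

Lemma locally'_of_neq (P : C -> Prop) (z : C) :
  (forall s : C, s <> z -> P s) -> locally' (T := C_UniformSpace) z P.
Proof. intros H; exists (mkposreal 1 Rlt_0_1); intros s _; apply H. Qed.

Theorem mainTheorem3 (q logq xi : C) (h a f : nat)
  (q_gt0 : (0 < Cmod q)%R) (q_lt1 : (Cmod q < 1)%R)
  (logqE : Cexp logq = q)
  (h_gt0 : (0 < h)%nat)
  (xi_root : exists r : nat, (0 < r)%nat /\ xi ^ r = 1)
  (a_gt0 : (0 < a)%nat) (a_lt_f : (a < f)%nat) :
  let H := partial_zeta q logq xi h a f in
  let res := q ^ (h * a) * xi ^ a * (RtoC (INR h) * logq)
             / (q ^ (h * f) * xi ^ f - 1) in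
  meromorphic H /\
  (forall s : C, s <> 1 -> holomorphic_at H s) /\
  simple_pole H 1 /\
  is_residue H 1 res /\
  filterlim (fun s => (s - 1) * H s)
    (locally' (T := C_UniformSpace) (RtoC 1)) (locally (T := C_UniformSpace) res).
Proof.
intros H res.
set (w := q ^ h * xi); set (L := RtoC (INR h) * logq).
destruct xi_root as [r [r_gt0 xi_r]].
assert (w_mod : Cmod w = (Cmod q ^ h)%R).
{ unfold w; rewrite Cmod_mult, Cmod_pow, (root_of_unity_Cmod xi r r_gt0 xi_r); ring. }
assert (w_neq0 : w <> 0) by (apply Cmod_gt_0; rewrite w_mod; apply pow_lt, q_gt0).
assert (w_lt1 : (Cmod w < 1)%R).
{ rewrite w_mod; apply pow_lt_1_compat; [split; [apply Cmod_ge_0|exact q_lt1]|lia]. }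
(* This keeps the pole from disappearing: log q = 0 would give q = 1, against |q| < 1. *)
assert (L_neq0 : L <> 0).
{ apply Cmult_neq_0.
  - intros E; apply RtoC_inj in E; apply (not_0_INR h); [lia|exact E].
  - intros E; rewrite E, Cexp_0 in logqE; rewrite <- logqE, Cmod_1 in q_lt1; lra. }
set (F := Dirichlet (class_power w a f) (fun n => ln (INR n))).
assert (HE : forall s : C, H s = F s - L / (s - 1) * F (s - 1)).
{ intros s; unfold H, partial_zeta; rewrite !partial_sum_Dirichlet; reflexivity. }
assert (F_der : forall s : C, ex_Cderive F s).
{ apply ex_Cderive_Dirichlet; [apply ln_INR_ge0|apply class_power_decay; assumption]. }
assert (F0 : F 0 = - (w ^ a / (w ^ f - 1))) by (apply Dirichlet_class_power_0; assumption).
assert (wf_neq1 : w ^ f - 1 <> 0) by (eapply w_pow_neq1; eassumption).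
assert (F0_neq0 : F 0 <> 0).
{ rewrite F0; intros E; apply (Cpow_nz w a w_neq0).
  replace (w ^ a) with (- (- (w ^ a / (w ^ f - 1))) * (w ^ f - 1)) by (field; exact wf_neq1).
  rewrite E; ring. }
assert (resE : res = - (L * F 0)).
{ unfold res; rewrite F0, !Cpow_mult_r, <- !Cpow_mult_l; fold w L.
  field; exact wf_neq1. }
(* This is (s - 1) H(s) with the denominator cleared. It is entire with g(1) = -L F(0), so it serves
   both as the numerator at the pole and as the continuous function giving the limit. *)
set (g := fun s => (s - 1) * F s - L * F (s - 1)).
assert (g_der : forall s : C, ex_Cderive g s).
{ intros s; apply ex_Cderive_minus; apply ex_Cderive_mult.
  - apply (ex_Cderive_shift (fun s => s)), ex_Cderive_id.
  - apply F_der.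
  - apply ex_Cderive_const.
  - apply ex_Cderive_shift, F_der. }
assert (g1 : g 1 = res).
{ unfold g; rewrite resE; replace (1 - 1) with (RtoC 0) by ring; ring. }
assert (Hg : forall s : C, s <> 1 -> (s - 1) * H s = g s).
{ intros s Hs; rewrite HE; unfold g; field; apply Cminus_eq_contra, Hs. }
assert (H_hol : forall s : C, s <> 1 -> holomorphic_at H s).
{ intros s Hs; unfold holomorphic_at.
  eapply filter_imp; [|exact (locally_neq s 1 Hs)]; intros t Ht.
  apply (ex_derive_ext (K := C_AbsRing) (fun s => F s - L * / (s - 1) * F (s - 1))).
  { intros; symmetry; apply HE. }
  apply ex_Cderive_minus; [apply F_der|]; apply ex_Cderive_mult.
  - apply ex_Cderive_mult; [apply ex_Cderive_const|].
    apply (ex_Cderive_shift Cinv), ex_Cderive_inv, Cminus_eq_contra, Ht.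
  - apply ex_Cderive_shift, F_der. }
assert (H_pole : simple_pole H 1).
{ split; [lia|]; exists g; split; [apply entire_holomorphic_at, g_der|]; split.
  - rewrite g1, resE; intros E; apply (Cmult_neq_0 _ _ L_neq0 F0_neq0).
    replace (L * F 0) with (- - (L * F 0)) by ring; rewrite E; ring.
  - apply locally'_of_neq; intros s Hs; rewrite <- Hg by exact Hs.
    field; apply Cminus_eq_contra, Hs. }
split; [|split; [exact H_hol|split; [exact H_pole|split]]].
- intros z; destruct (Ceq_dec z 1) as [->|Hz]; [right; exists 1%nat; exact H_pole|].
  left; apply H_hol, Hz.
- destruct (Dirichlet_Taylor2_0 (class_power w a f) (fun n => ln (INR n)))
    as [A [M [K HK]]]; [apply ln_INR_ge0|apply class_power_decay; assumption|].
  destruct (slope_extends F A M K F_der HK) as [G [GE G_der]].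
  (* The principal part has a single term. Writing F(s - 1) = F(0) + (s - 1) G(s - 1) splits L F(s -
     1) / (s - 1) into L F(0) / (s - 1) and the entire function L G(s - 1). *)
  exists 0%nat, (fun _ => res), (fun s => F s - L * G (s - 1)); split; [|split].
  + apply entire_holomorphic_at; intros s; apply ex_Cderive_minus; [apply F_der|].
    apply ex_Cderive_mult; [apply ex_Cderive_const|apply ex_Cderive_shift, G_der].
  + apply locally'_of_neq; intros s Hs.
    assert (Hs1 : s - 1 <> 0) by (apply Cminus_eq_contra, Hs).
    rewrite sum_O, HE, GE, resE, Cpow_1_r by exact Hs1; field; exact Hs1.
  + reflexivity.
- rewrite <- g1.
  (* Off 1 the product (s - 1) H(s) is g(s), so the limit is g(1) by continuity; [locally_C]
     reconciles the two uniform structures on the domain. *)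
  apply (filterlim_ext_loc g).
  { apply locally'_of_neq; intros s Hs; symmetry; apply Hg, Hs. }
  eapply filterlim_filter_le_1; [apply filter_le_within|].
  pose proof (ex_derive_continuous (K := C_AbsRing) (V := C_NormedModule) g
    (RtoC 1) (g_der 1)) as Hc.
  intros P HP; apply locally_C, Hc, HP.
Qed.
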